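(* Let $E$ be a finite set and let $f:2^E\to\mathbb{Z}$ be a submodular function. Let $$EP_f:=\{x\in\mathbb{R}^E : x(U)\le f(U)\text{ for all }U\subseteq E\},$$ $$P_f:=\{x\in EP_f : x(U)\ge 0\text{ for all }U\subseteq E\},\qquad B_f:=\{x\in EP_f : x(E)=f(E)\}.$$ Then $EP_f, P_f, B_f\in\mathcal{P}$, i.e. for each $P\in\{EP_f,P_f,B_f\}$, any $k\in\mathbb{Z}_{\geq 0}$, any $r\in\{0,\ldots,k\}$ and any $w\in\mathbb{Z}^E$, the intersection $rP\cap(w-(k-r)P)$ is box-integer. In particular, each of these polyhedra and their projections have the Integer Carathéodory Property.
   Context: $2^E$ denotes the power set of $E$. A function $f:2^E\to\mathbb{Z}$ is submodular if $f(A)+f(B)\ge f(A\cup B)+f(A\cap B)$ for all $A,B\subseteq E$. For $x\in\mathbb{R}^E$ and $U\subseteq E$, $x(U)=\sum_{e\in U}x(e)$. ($EP_f$ is the extended polymatroid, $P_f$ the polymatroid, and $B_f$ the base polytope of $f$.) $\mathcal{P}$ denotes the set of rational polyhedra $P\subseteq\mathbb{R}^n$ (for some $n$) such that for any $k\in\mathbb{Z}_{\ge0}$, $r\in\{0,\ldots,k\}$, $w\in\mathbb{Z}^n$ the intersection $rP\cap(w-(k-r)P)$ is box-integer; here $\mathbb{R}^E$ is identified with $\mathbb{R}^{|E|}$. For a real number $t\ge 0$, $tP=\{tx: x\in P\}$, and $w-tP=\{w-tx: x\in P\}$. Inequalities between vectors are componentwise. Let $\bar{\mathbb{Z}}=\mathbb{Z}\cup\{-\infty,+\infty\}$.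 A polyhedron is called an integer polyhedron if each of its (nonempty) faces contains an integer point (in particular the empty polyhedron is an integer polyhedron). A polyhedron $Q\subseteq\mathbb{R}^n$ is box-integer if for every pair of vectors $c\le d$ in $\bar{\mathbb{Z}}^n$, the set $\{x\in Q: c\le x\le d\}$ is an integer polyhedron. A projection of a polyhedron means its image under the coordinate projection onto some subset of the coordinates. A polyhedron $Q\subseteq\mathbb{R}^d$ has the Integer Carathéodory Property (ICP) if for every positive integer $k$ and every integer vector $w\in kQ$ there exist affinely independent $x_1,\ldots,x_t\in Q\cap\mathbb{Z}^d$ and $n_1,\ldots,n_t\in\mathbb{Z}_{\ge 0}$ such that $n_1+\cdots+n_t=k$ and $w=\sum_{i} n_i x_i$. *)

(* Defs.v *)
From mathcomp Require Export all_boot all_order all_algebra.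
From mathcomp Require Export all_classical all_reals.
Export Order.TTheory GRing.Theory Num.Theory.

Set Implicit Arguments.
Unset Strict Implicit.
Unset Printing Implicit Defensive.

Local Open Scope classical_set_scope.
Local Open Scope ring_scope.

(* The space R^I is indexed by an arbitrary finite type I: R^n is the case     *)
(* I = 'I_n, and no enumeration of I is needed.  The codomain R^o, which is    *)
(* convertible to R, gives {ffun I -> R^o} its vector space structure over R.  *)

Section Polyhedra.
Variables (R : realType) (I : finType).
Implicit Types (P Q F : set {ffun I -> R^o}) (x w : {ffun I -> R^o}).

Definition integral_vector (x : I -> R) : Prop := forall i, x i \is a Num.int.

Definition dotp (a x : I -> R) : R := \sum_i a i * x i.

Definition is_polyhedron Q : Prop :=
  exists (m : nat) (A : 'I_m -> I -> R) (b : 'I_m -> R),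
    Q = [set x : {ffun I -> R^o} | forall j, dotp (A j) x <= b j].

Definition is_rational_polyhedron Q : Prop :=
  exists (m : nat) (A : 'I_m -> I -> rat) (b : 'I_m -> rat),
    Q = [set x : {ffun I -> R^o} |
          forall j, dotp (fun i => ratr (A j i)) x <= ratr (b j)].

(* a = 0 is allowed, so Q itself is a face of Q; the empty face may occur. *)
Definition is_face F Q : Prop :=
  exists (a : I -> R) (d : R),
    (forall x, Q x -> dotp a x <= d) /\
    F = [set x : {ffun I -> R^o} | Q x /\ dotp a x = d].

Definition integer_polyhedron Q : Prop :=
  is_polyhedron Q /\
  forall F, is_face F Q -> F !=set0 -> exists2 x, F x & integral_vector x.

Definition box (c d : I -> \bar int) : set {ffun I -> R^o} :=
  [set x : {ffun I -> R^o} |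
    forall i, (er_map intr (c i) <= (x i : R)%:E)%E /\
              ((x i : R)%:E <= er_map intr (d i))%E].

Definition box_integer Q : Prop :=
  is_polyhedron Q /\
  forall c d : I -> \bar int, (forall i, (c i <= d i)%E) ->
    integer_polyhedron (Q `&` box c d).

Definition dilate (t : R) P : set {ffun I -> R^o} :=
  [set t *: x | x in P].

Definition reflect_dilate w (t : R) P : set {ffun I -> R^o} :=
  [set w - t *: x | x in P].

Definition box_integer_class P : Prop :=
  is_rational_polyhedron P /\
  forall (k r : nat) w, (r <= k)%N -> integral_vector w ->
    box_integer (dilate r%:R P `&` reflect_dilate w (k - r)%:R P).

Definition affinely_independent (t : nat) (x : 'I_t -> {ffun I -> R^o}) : Prop :=
  forall l : 'I_t -> R,
    \sum_i l i = 0 -> \sum_i l i *: x i = 0 -> forall i, l i = 0.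

Definition integer_caratheodory Q : Prop :=
  is_polyhedron Q /\
  forall (k : nat) w, (0 < k)%N -> integral_vector w -> dilate k%:R Q w ->
    exists (t : nat) (x : 'I_t -> {ffun I -> R^o}) (n : 'I_t -> nat),
      [/\ affinely_independent x,
          (forall i, Q (x i) /\ integral_vector (x i)),
          (\sum_i n i)%N = k
        & w = \sum_i (n i)%:R *: x i].

Definition projection (S : {set I}) Q : set {ffun {i : I | i \in S} -> R^o} :=
  [set [ffun j => x (val j)] | x in Q].

End Polyhedra.

Definition submodular (E : finType) (f : {set E} -> int) : Prop :=
  forall A B : {set E}, f (A :|: B) + f (A :&: B) <= f A + f B.

Section Polymatroids.
Variables (R : realType) (E : finType) (f : {set E} -> int).

Definition vsum (x : E -> R) (U : {set E}) : R := \sum_(e in U) x e.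

Definition extended_polymatroid : set {ffun E -> R^o} :=
  [set x : {ffun E -> R^o} | forall U : {set E}, vsum x U <= (f U)%:~R].

Definition polymatroid : set {ffun E -> R^o} :=
  [set x : {ffun E -> R^o} |
    extended_polymatroid x /\ forall U : {set E}, 0 <= vsum x U].

Definition base_polytope : set {ffun E -> R^o} :=
  [set x : {ffun E -> R^o} |
    extended_polymatroid x /\ vsum x [set: E] = (f [set: E])%:~R].

End Polymatroids.

Arguments projection {R I} S Q.
Arguments extended_polymatroid R {E} f.
Arguments polymatroid R {E} f.
Arguments base_polytope R {E} f.

(* Main.v *)
(** Extended polymatroids, polymatroids, base polytopes and all their coordinate
    projections are integral generalized polymatroids
    [Q = {x | lo U <= x(U) <= up U}], so it suffices to treat such a [Q].

    Box-integrality of [rQ /\ (w - (k-r)Q)]: move a point of a face inside its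
    integer cell until no further constraint can be made tight.  If the point
    had a fractional coordinate, then the tight sets of each of the two
    generalized polymatroids would partition the coordinates (after adding a
    coordinate [x_* = - x(E)]) into classes of integral sum; the fractional
    coordinates are then the edges of a bipartite multigraph without vertices of
    degree one, which carries a nonzero circulation along which one can move.

    Integer Caratheodory property: let [w] be an integral point of [kQ] within
    [k] times an integer box [c <= x <= u <= c + 1].  If [c e < u e], then
    integer decomposition splits [w] into a part in a multiple of the face
    [x_e = u e] and a part in a multiple of the face [x_e = c e].  Choose this
    splitting at an (integral) vertex of the polytope of all splittings and
    apply induction to both parts: the vertex property makes the directions
    spanned by the two affinely independent families independent. *)
Require Import Defs.
From mathcomp Require Import lra zify.

Set Implicit Arguments.
Unset Strict Implicit.
Unset Printing Implicit Defensive.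

Local Open Scope ring_scope.

(** * Sums of a vector over sets of coordinates *)

Section Vsum.
Variables (R : realType) (E : finType).
Implicit Types (x y d : {ffun E -> R^o}) (A B U : {set E}).

Lemma vsumD x y U : vsum (x + y) U = vsum x U + vsum y U.
Proof. by rewrite /vsum -big_split; apply: eq_bigr => e _; rewrite ffunE. Qed.

Lemma vsumZ (t : R) x U : vsum (t *: x) U = t * vsum x U.
Proof. by rewrite /vsum mulr_sumr; apply: eq_bigr => e _; rewrite ffunE. Qed.

Lemma vsumB x y U : vsum (x - y) U = vsum x U - vsum y U.
Proof. by rewrite -scaleN1r vsumD vsumZ mulN1r. Qed.

Lemma vsum0 U : vsum (0 : {ffun E -> R^o}) U = 0.
Proof. by rewrite /vsum big1 // => e _; rewrite ffunE. Qed.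

Lemma vsum1 (x : E -> R) e : vsum x [set e] = x e.
Proof. by rewrite /vsum big_set1. Qed.

Lemma vsum_set0 (x : E -> R) : vsum x finset.set0 = 0.
Proof. by rewrite /vsum big_set0. Qed.

Lemma vsum_sum (I : finType) (n : I -> R) (x : I -> {ffun E -> R^o}) U :
  vsum (\sum_i n i *: x i) U = \sum_i n i * vsum (x i) U.
Proof.
rewrite /vsum (eq_bigr (fun e => \sum_i n i * x i e)); last first.
  by move=> e _; rewrite sum_ffunE; apply: eq_bigr => i _; rewrite ffunE.
by rewrite exchange_big; apply: eq_bigr => i _; rewrite mulr_sumr.
Qed.

Lemma vsumID (x : E -> R) A B :
  vsum x A = vsum x (A :&: B) + vsum x (A :\: B).
Proof. by rewrite /vsum (big_setID B). Qed.

Lemma vsum_setUI (x : E -> R) A B :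
  vsum x (A :|: B) + vsum x (A :&: B) = vsum x A + vsum x B.
Proof.
rewrite (vsumID x (A :|: B) A) (vsumID x B A) finset.setUK.
by rewrite finset.setDUl finset.setDv finset.set0U (finset.setIC B); lra.
Qed.

Lemma vsum_setDD (x : E -> R) A B :
  vsum x (A :\: B) - vsum x (B :\: A) = vsum x A - vsum x B.
Proof. by rewrite (vsumID x A B) (vsumID x B A) finset.setIC; lra. Qed.

Lemma vsum_setC (x : E -> R) A :
  vsum x (~: A) = vsum x [set: E] - vsum x A.
Proof.
by rewrite (vsumID x [set: E] A) finset.setTI finset.setTD addrAC subrr add0r.
Qed.

Lemma vsum_int (x : E -> R) A : integral_vector x -> vsum x A \is a Num.int.
Proof. by move=> xZ; apply: rpred_sum => e _; apply: xZ. Qed.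

End Vsum.

(** * Linear systems with fewer equations than unknowns *)

Section Underdetermined.
Variables (R : realType) (I J : finType).

(** A nonzero left kernel vector of the [A] by [B] submatrix of [M], extended by zero, serves as
    [d]. *)
Lemma underdetermined (A : {set I}) (B : {set J}) (M : I -> J -> R) :
  (#|B| < #|A|)%N ->
  exists d : I -> R,
    [/\ exists i, d i != 0, forall i, i \notin A -> d i = 0
      & forall j, j \in B -> \sum_i d i * M i j = 0].
Proof.
move=> ltBA.
pose N : 'M[R]_(#|A|, #|B|) := \matrix_(i, j) M (enum_val i) (enum_val j).
have kerN0 : kermx N != 0.
  rewrite kermx_eq0 /row_free; apply/negP => /eqP rN.
  by move: ltBA; rewrite -rN ltnNge rank_leq_col.
have [v vN v0] : exists2 v : 'rV_#|A|, v *m N = 0 & v != 0.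
  have /row_subPn[i] : ~~ (kermx N <= (0 : 'M_#|A|))%MS by rewrite submx0.
  rewrite submx0 => ri; exists (row i (kermx N)) => //.
  by rewrite -row_mul mulmx_ker row0.
pose d i := \sum_(a < #|A| | enum_val a == i) v ord0 a.
have dE a : d (enum_val a) = v ord0 a.
  rewrite /d (bigD1 a) //= big1 ?addr0 // => b /andP[/eqP/enum_val_inj->].
  by rewrite eqxx.
have dout i : i \notin A -> d i = 0.
  by move=> iA; rewrite /d big1 // => a /eqP ai; rewrite -ai enum_valP in iA.
exists d; split => //.
  have /rV0Pn[a va] := v0; by exists (enum_val a); rewrite dE.
move=> j jB.
rewrite (bigID (mem A)) /= [X in _ + X]big1 ?addr0; last first.
  by move=> i /dout->; rewrite mul0r.
rewrite big_enum_val /=.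
have := congr1 (fun X : 'rV_#|B| => X ord0 (enum_rank_in jB j)) vN.
rewrite !mxE => vNj; rewrite -[RHS]vNj; apply: eq_bigr => a _.
by rewrite mxE dE enum_rankK_in.
Qed.

End Underdetermined.

(** * Vertices of a system of linear inequalities *)

Section Vertex.
Variables (R : realType) (V : lmodType R) (J : finType) (act : pred J).
Variables (phi : J -> V -> R) (b : J -> R).
Hypothesis phi_affine : forall j x t d, phi j (x + t *: d) = phi j x + t * phi j d.
Implicit Types x y d : V.

Definition feasible x := forall j, act j -> phi j x <= b j.

Definition tight x : {set J} := [set j | act j && (phi j x == b j)].

Lemma two_sided x d : feasible x -> (forall j, j \in tight x -> phi j d = 0) ->
  exists2 e : R, 0 < e & feasible (x + e *: d) /\ feasible (x + (- e) *: d).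
Proof.
move=> xf td.
(* The least ratio of slack to absolute slope; the default 1 serves when no slope is nonzero. *)
pose e : R := \big[Num.min/1]_(j | act j && (phi j d != 0))
                ((b j - phi j x) / `|phi j d|).
have e_le j : act j -> e * `|phi j d| <= b j - phi j x.
  move=> aj; have [->|nz] := eqVneq (phi j d) 0.
    by rewrite normr0 mulr0 subr_ge0 xf.
  rewrite -ler_pdivlMr ?normr_gt0 //.
  by apply: bigmin_le_cond; rewrite aj nz.
have e0 : 0 < e.
  apply: lt_bigmin => // j /andP[aj nz].
  rewrite divr_gt0 ?normr_gt0 // subr_gt0 lt_neqAle xf // andbT.
  by apply: contra nz => tj; rewrite td // inE aj.
exists e => //; split=> j aj; rewrite phi_affine; have := e_le _ aj;
  case: (ler0P (phi j d)) => sgn; nra.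
Qed.

(** Ratio test: move along [d] until the first constraint of positive slope becomes tight; [j0]
    ensures that there is one. *)
Lemma advance x d j0 : feasible x -> (forall j, j \in tight x -> phi j d = 0) ->
  act j0 -> 0 < phi j0 d ->
  exists2 t : R, feasible (x + t *: d) & tight x \proper tight (x + t *: d).
Proof.
move=> xf td aj0 pj0.
pose P j := act j && (0 < phi j d).
pose F j := (b j - phi j x) / phi j d.
have Pj0 : P j0 by rewrite /P aj0.
case: (@Order.TotalTheory.arg_minP _ _ _ j0 P F Pj0) => j /andP[aj pj] jmin.
have t0 : 0 <= F j by rewrite divr_ge0 ?subr_ge0 ?xf // ltW.
exists (F j).
  move=> i ai; rewrite phi_affine; have [pi|pi] := ltP 0 (phi i d).
    have := jmin i; rewrite /P ai pi => /(_ isT).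
    by rewrite [F i]/F ler_pdivlMr //; lra.
  have := xf i ai; nra.
apply/properP; split.
  apply/fintype.subsetP => i it; move: (it); rewrite !inE => /andP[-> /eqP xi].
  by rewrite phi_affine td // mulr0 addr0 xi eqxx.
exists j; last by apply: contraTN pj => /td->; rewrite ltxx.
rewrite inE aj phi_affine; apply/eqP; rewrite /F divfK ?gt_eqF //; lra.
Qed.

(** While some direction preserves the tight constraints but changes an active one, [advance]
    enlarges the tight set. A functional maximal at [x] is constant along such a direction by
    [two_sided], so [y] stays in every face containing [x]. *)
Lemma vertex_exists x : feasible x ->
  exists y,
    [/\ feasible y,
        forall psi : V -> R,
          (forall z t d, psi (z + t *: d) = psi z + t * psi d) ->
          (forall z, feasible z -> psi z <= psi x) -> psi y = psi x
      & forall d, (forall j, j \in tight y -> phi j d = 0) ->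
          forall j, act j -> phi j d = 0].
Proof.
have [n] := ubnP (#|J| - #|tight x|)%N; elim: n x => // n IHn x ltn xf.
have [stuck|] := pselect (forall d, (forall j, j \in tight x -> phi j d = 0) ->
  forall j, act j -> phi j d = 0); first by exists x; split.
move=> /existsNP[d /not_implyP[td /existsNP[j /not_implyP[aj /eqP nz]]]].
wlog pj : d td nz / 0 < phi j d.
  move=> hw; have [pj|pj] := ltP 0 (phi j d); first exact: (hw d).
  have phiN i : phi i (- d) = - phi i d.
    have := phi_affine i d (-1) d; rewrite scaleN1r subrr => phi0.
    by have := phi_affine i 0 (-1) d; rewrite scaleN1r add0r => ->; lra.
  apply: (hw (- d)); rewrite ?phiN ?oppr_eq0 //.
    by move=> i it; rewrite phiN td // oppr0.
  by rewrite oppr_gt0 lt_neqAle nz.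
have [t yf lt_tight] := advance xf td aj pj.
have [|y [yfeas yface ystuck]] := IHn _ _ yf.
  have := proper_card lt_tight; have := max_card (tight (x + t *: d)); lia.
exists y; split=> // psi psi_affine psi_max.
have psid : psi d = 0.
  have [e e0 [/psi_max + /psi_max]] := two_sided xf td.
  by rewrite !psi_affine; nra.
by rewrite yface // psi_affine psid mulr0 addr0.
Qed.

End Vertex.

(** * Circulations on fractional coordinates *)

Section FractionalCirculation.
Variables (R : realType) (T V : finType) (x : T -> R).

Definition fractional : {set T} := [set t | x t \isn't a Num.int].

Definition fibers_int (p : T -> V) :=
  forall v, \sum_(t | p t == v) x t \is a Num.int.

(** A class of integral sum cannot contain exactly one fractional element. *)
Lemma fibers_int_card (p : T -> V) : fibers_int p ->
  (2 * #|p @: fractional| <= #|fractional|)%N.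
Proof.
move=> pZ; rewrite -[#|fractional|]sum1_card.
rewrite (partition_big_imset p) /= mulnC -sum_nat_const.
apply: leq_sum => _ /imsetP[t tF ->]; rewrite sum1_card.
rewrite (cardD1 t) unfold_in tF eqxx ltnS.
rewrite lt0n; apply: contraPneq tF => /eqP/pred0P other0.
rewrite inE; apply/negP; rewrite negbK.
have := pZ (p t); rewrite (bigD1 t) //= rpredDr // rpred_sum // => s /andP[ps st].
apply: contraFT (other0 s) => sF.
by rewrite /= st unfold_in ps inE sF.
Qed.

(* The equations are those of a bipartite multigraph with edge set            *)
(* [fractional]: every vertex has degree at least 2, so there are at most as  *)
(* many equations as unknowns, and one of them is redundant because both      *)
(* sides sum to the total.                                                    *)
Lemma fractional_circulation (p q : T -> V) (t0 : T) :
  fibers_int p -> fibers_int q -> t0 \in fractional ->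
  exists d : T -> R,
    [/\ exists t, d t != 0, forall t, x t \is a Num.int -> d t = 0,
        forall v, \sum_(t | p t == v) d t = 0
      & forall v, \sum_(t | q t == v) d t = 0].
Proof.
move=> pZ qZ t0F.
pose eqs : {set V + V} :=
  [set inl v | v in p @: fractional]
    :|: [set inr v | v in q @: fractional :\ q t0].
pose M (t : T) (e : V + V) : R :=
  match e with inl v => (p t == v)%:R | inr v => (q t == v)%:R end.
have q0 : q t0 \in q @: fractional by apply: imset_f.
have lt_eqs : (#|eqs| < #|fractional|)%N.
  have inl_inj : injective (@inl V V) by move=> ? ? [].
  have inr_inj : injective (@inr V V) by move=> ? ? [].
  have [+ _] := leq_card_setU [set inl v | v in p @: fractional]
    [set inr v | v in q @: fractional :\ q t0].
  rewrite -/eqs (card_imset _ inl_inj) (card_imset _ inr_inj).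
  have := cardsD1 (q t0) (q @: fractional); rewrite q0 add1n.
  have := fibers_int_card pZ; have := fibers_int_card qZ.
  move: #|_ :\ _| #|eqs| #|fractional| #|p @: _| #|q @: _| => c e F a b; lia.
have [d [d_neq0 d_out d_eqs]] := underdetermined M lt_eqs.
have sumM (r : T -> V) v :
    \sum_t d t * (r t == v)%:R = \sum_(t | r t == v) d t.
  rewrite [RHS]big_mkcond; apply: eq_bigr => t _.
  by case: ifP; rewrite ?mulr1 ?mulr0.
have off (r : T -> V) v : v \notin r @: fractional -> \sum_(t | r t == v) d t = 0.
  move=> vr; rewrite big1 // => t /eqP rt; apply: d_out.
  by apply: contra vr => tF; rewrite -rt imset_f.
have dp v : \sum_(t | p t == v) d t = 0.
  have [vp|/off//] := boolP (v \in p @: fractional).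
  rewrite -sumM; apply: (d_eqs (inl v)); rewrite inE; apply/orP; left.
  exact: imset_f.
have dq v : v != q t0 -> \sum_(t | q t == v) d t = 0.
  move=> vq0; have [vq|/off//] := boolP (v \in q @: fractional).
  rewrite -sumM; apply: (d_eqs (inr v)); rewrite inE; apply/orP; right.
  by apply: imset_f; rewrite !inE vq0.
exists d; split=> //.
  by move=> t tZ; apply: d_out; rewrite inE negbK.
move=> v; have [->|/dq//] := eqVneq v (q t0).
have total (r : T -> V) : \sum_t d t = \sum_v \sum_(t | r t == v) d t.
  exact: partition_big.
have := total q; rewrite (total p) big1 => [|u _]; last exact: dp.
by rewrite (bigD1 (q t0)) //= [X in _ + X]big1 ?addr0 => [<-//|u]; apply: dq.
Qed.

End FractionalCirculation.

(** * Lattices of sets and the partitions they induce *)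

Section SetLattice.
Variables (R : realType) (T : finType) (D : {pred {set T}}).
Hypotheses (D0 : finset.set0 \in D) (DT : [set: T] \in D).
Hypothesis DU : forall A B, A \in D -> B \in D -> A :|: B \in D.
Hypothesis DI : forall A B, A \in D -> B \in D -> A :&: B \in D.

(** The fibers of [hull] are the classes of elements that no member of [D] separates. *)
Definition hull (t : T) : {set T} := \bigcap_(A | (A \in D) && (t \in A)) A.

Lemma hull_in t : hull t \in D.
Proof. by rewrite /hull; elim/big_ind: _ => // A /andP[]. Qed.

Lemma mem_hull t : t \in hull t.
Proof. by apply/bigcapP => A /andP[]. Qed.

Lemma hull_sub t A : A \in D -> t \in A -> hull t \subset A.
Proof. by move=> AD tA; rewrite /hull (bigD1 A) ?AD //= finset.subsetIl. Qed.

(** Every member of [D] is a union of fibers of [hull]. *)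
Lemma sum_lattice0 (d : T -> R) :
  (forall C, \sum_(t | hull t == C) d t = 0) ->
  forall A, A \in D -> \sum_(t in A) d t = 0.
Proof.
move=> dC A AD; rewrite (partition_big hull predT) //= big1 // => C _.
have [t tA|none] := pickP [pred t | (t \in A) && (hull t == C)].
  rewrite -[RHS](dC C); apply: eq_bigl => s.
  case: (eqVneq (hull s) C) => [sC|]; rewrite ?andbF // andbT.
  case/andP: tA => tA /eqP tC.
  by apply: (fintype.subsetP (hull_sub AD tA)); rewrite tC -sC mem_hull.
by rewrite big1 // => t tA; have := none t; rewrite /= tA.
Qed.

(** The fiber through [t] is [hull t] minus the union [L] of the smaller hulls inside it, and both
    sets belong to [D]. *)
Lemma fibers_hull_int (x : T -> R) :
  (forall A, A \in D -> \sum_(t in A) x t \is a Num.int) ->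
  fibers_int x hull.
Proof.
move=> xZ C; have [t /eqP <-|none] := pickP [pred t | hull t == C]; last first.
  by rewrite big1 // => t tC; have := none t; rewrite /= tC.
pose L := \bigcup_(s in hull t | hull s != hull t) hull s.
have LD : L \in D.
  by rewrite /L; elim/big_ind: _ => // s _; apply: hull_in.
have hullI : hull t :&: L = L.
  apply/finset.setIidPr/bigcupsP => s /andP[st _].
  exact: hull_sub (hull_in t) st.
have := rpredB (xZ _ (hull_in t)) (xZ _ LD).
rewrite (big_setID L) /= hullI addrAC subrr add0r.
rewrite (eq_bigl (fun s => hull s == hull t)) // => s.
rewrite inE; apply/andP/eqP => [[sL st]|st].
  apply/eqP; apply: contraNT sL => ne.
  by apply/bigcupP; exists s; rewrite ?mem_hull // st.
rewrite -st mem_hull; split=> //; apply/bigcupP => -[r /andP[rt ne] sr].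
case/eqP: ne; apply/eqP; rewrite finset.eqEsubset hull_sub ?hull_in //=.
by rewrite -st hull_sub // hull_in.
Qed.

End SetLattice.

(** * Generalized polymatroids *)

Lemma big_option (V : nmodType) (T : finType) (F : option T -> V) :
  \sum_t F t = F None + \sum_e F (Some e).
Proof.
by rewrite ![index_enum _]unlock [@Finite.enum in LHS]unlock /= big_cons big_map.
Qed.

Section GeneralizedPolymatroid.
Variable E : finType.

(* The lower bounds [lo] are in force only if [bd] holds; otherwise they      *)
(* stand for -oo.                                                             *)
Record gpm := Gpm { up : {set E} -> int; lo : {set E} -> int; bd : bool }.

(** The last clause is the cross inequality linking the two bounds. No value at the empty set is
    prescribed, so [gpoly] may be empty. *)
Definition paramodular (p : gpm) : Prop :=
  [/\ submodular (up p),
      bd p -> forall A B, lo p A + lo p B <= lo p (A :|: B) + lo p (A :&: B)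
    & bd p -> forall A B, up p (A :\: B) - lo p (B :\: A) <= up p A - lo p B].

Definition gpm_scale (n : nat) (p : gpm) : gpm :=
  Gpm (fun U => up p U *+ n) (fun U => lo p U *+ n) (bd p).

Lemma paramodular_scale n p : paramodular p -> paramodular (gpm_scale n p).
Proof.
case=> sub super cross; split=> /=.
- by move=> A B; rewrite -!mulrnDl lerMn2r sub orbT.
- by move=> b A B; rewrite -!mulrnDl lerMn2r super ?orbT.
- by move=> b A B; rewrite -!mulrnBl lerMn2r cross ?orbT.
Qed.

Variable R : realType.
Implicit Types (p q : gpm) (x y z d w : {ffun E -> R^o}).

Definition gpoly p : set {ffun E -> R^o} :=
  [set x | forall U, vsum x U <= (up p U)%:~R /\
                     (bd p -> (lo p U)%:~R <= vsum x U)]%classic.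

(** For [x] in [gpoly p], the direction space of the minimal face containing [x]. *)
Definition tight_dir p x d : Prop :=
  forall U, (vsum x U = (up p U)%:~R -> vsum d U = 0) /\
            (bd p -> vsum x U = (lo p U)%:~R -> vsum d U = 0).

(* A generalized polymatroid is the projection of a base polytope with one    *)
(* more coordinate [None], along which the lower bounds for [U] become upper  *)
(* bounds for its complement.                                                 *)
Definition ext (x : E -> R) (t : option E) : R :=
  if t is Some e then x e else - vsum x [set: E].

Lemma sum_ext (x : E -> R) (W : {set option E}) :
  \sum_(t in W) ext x t =
  if None \in W then - vsum x (~: (Some @^-1: W)) else vsum x (Some @^-1: W).
Proof.
rewrite big_mkcond big_option /= -(big_mkcond (fun e => Some e \in W)).
have -> : \sum_(e | Some e \in W) x e = vsum x (Some @^-1: W).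
  by apply: eq_bigl => e; rewrite inE.
by case: ifP => _; rewrite ?add0r // vsum_setC opprB addrC.
Qed.

(** The tight sets after adding the coordinate [None]. The empty and the full set are put in by
    hand, since [up] and [lo] need not vanish at the empty set. *)
Definition tight_family p x : {set {set option E}} :=
  [set W : {set option E} | if None \in W
           then (W == [set: option E]) ||
                (bd p && (vsum x (~: (Some @^-1: W)) == (lo p (~: (Some @^-1: W)))%:~R))
           else (W == finset.set0) ||
                (vsum x (Some @^-1: W) == (up p (Some @^-1: W))%:~R)].

Lemma tight_familyP p x W :
  reflect [\/ W = finset.set0, W = [set: option E],
     None \notin W /\ vsum x (Some @^-1: W) = (up p (Some @^-1: W))%:~R
   | None \in W /\
     (bd p /\ vsum x (~: (Some @^-1: W)) = (lo p (~: (Some @^-1: W)))%:~R)]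
  (W \in tight_family p x).
Proof.
rewrite inE; apply: (iffP idP).
  case: ifP => NW.
    case/orP => [/eqP->|/andP[b /eqP t]]; first by constructor 2.
    by constructor 4.
  case/orP => [/eqP->|/eqP t]; first by constructor 1.
  by constructor 3; split=> //; apply/negbT.
case=> [->|->|[/negbTE-> ->]|[-> [-> ->]]]; rewrite ?eqxx ?orbT //.
- by rewrite finset.in_set0.
- by rewrite finset.in_setT.
Qed.

Lemma tight_family0 p x : finset.set0 \in tight_family p x.
Proof. by apply/tight_familyP; constructor 1. Qed.

Lemma tight_familyT p x : [set: option E] \in tight_family p x.
Proof. by apply/tight_familyP; constructor 2. Qed.

(** Uncrossing: tightness of [A] and [B] forces equality in the submodular inequality, the
    supermodular one, or the cross inequality, according to whether [None] lies in neither, both or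
    one of them. *)
Lemma tight_familyUI p x A B : paramodular p -> gpoly p x ->
  A \in tight_family p x -> B \in tight_family p x ->
  (A :|: B \in tight_family p x) /\ (A :&: B \in tight_family p x).
Proof.
move=> [sub super cross] xP.
have [F0 FT] := (tight_family0 p x, tight_familyT p x).
wlog: A B / (None \in A) ==> (None \in B) => [hw AF BF|].
  have [/hw|] := boolP ((None \in A) ==> (None \in B)); first exact.
  rewrite negb_imply => /andP[NA _].
  by rewrite finset.setUC finset.setIC; apply: hw; rewrite // NA implybT.
move=> imp AF BF; move: imp.
case/tight_familyP: (AF) => [->|->|[NA tA]|[NA [b tA]]] imp.
- by rewrite finset.set0U finset.set0I.
- by rewrite finset.setTU finset.setTI.
- case/tight_familyP: (BF) => [->|->|[NB tB]|[NB [b tB]]].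
  + by rewrite finset.setU0 finset.setI0.
  + by rewrite finset.setUT finset.setIT.
  + move: tA tB; set A' := Some @^-1: A; set B' := Some @^-1: B => tA tB.
    have [u1 _] := xP (A' :|: B'); have [u2 _] := xP (A' :&: B').
    have := sub A' B'; rewrite -(ler_int R) !rmorphD /= => AB.
    have sAB := vsum_setUI x A' B'.
    split; apply/tight_familyP; constructor 3.
      by rewrite !inE negb_or NA NB preimsetU; split=> //; lra.
    by rewrite !inE negb_and NA preimsetI; split=> //; lra.
  + move: tA tB; set A' := Some @^-1: A; set B' := Some @^-1: B => tA tB.
    have [u1 _] := xP (A' :\: ~: B'); have [_ /(_ b) u2] := xP (~: B' :\: A').
    have := cross b A' (~: B'); rewrite -(ler_int R) !rmorphB /= => AB.
    have sAB := vsum_setDD x A' (~: B').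
    split; apply/tight_familyP; [constructor 4|constructor 3].
      rewrite inE NB orbT preimsetU; split=> //; split=> //.
      have -> : ~: (A' :|: B') = ~: B' :\: A'.
        by apply/setP => e; rewrite !inE negb_or.
      by lra.
    rewrite inE negb_and NA preimsetI; split=> //.
    have -> : A' :&: B' = A' :\: ~: B' by rewrite finset.setDE finset.setCK.
    by lra.
- rewrite NA /= in imp.
  case/tight_familyP: (BF) => [->|->|[NB' _]|[_ [_ tB]]].
  + by rewrite finset.setU0 finset.setI0.
  + by rewrite finset.setUT finset.setIT.
  + by rewrite imp in NB'.
  + move: tA tB.
    set A' := ~: (Some @^-1: A); set B' := ~: (Some @^-1: B) => tA tB.
    have [_ /(_ b) u1] := xP (A' :|: B'); have [_ /(_ b) u2] := xP (A' :&: B').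
    have := super b A' B'; rewrite -(ler_int R) !rmorphD /= => AB.
    have sAB := vsum_setUI x A' B'.
    split; apply/tight_familyP; constructor 4.
      by rewrite inE NA preimsetU finset.setCU; do 2!split=> //; lra.
    by rewrite inE NA imp preimsetI finset.setCI; do 2!split=> //; lra.
Qed.

Lemma tight_family_int p x A : A \in tight_family p x ->
  \sum_(t in A) ext x t \is a Num.int.
Proof.
rewrite sum_ext => /tight_familyP[->|->|[/negbTE-> ->]|[-> [_ ->]]];
  rewrite ?rpredN ?intr_int //.
  by rewrite finset.in_set0 finset.preimset0 vsum_set0 rpred0.
by rewrite finset.in_setT finset.preimsetT finset.setCT vsum_set0 rpredN rpred0.
Qed.

(** The two tight families are lattices with integral sums. A circulation for both induced
    partitions sums to zero over every tight set. *)
Lemma fractional_direction p q w x e0 :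
  paramodular p -> paramodular q -> integral_vector w ->
  gpoly p x -> gpoly q (w - x) -> x e0 \isn't a Num.int ->
  exists d, [/\ d != 0, forall e, x e \is a Num.int -> d e = 0,
                tight_dir p x d & tight_dir q (w - x) d].
Proof.
move=> pP qP wZ xp xq xe0.
have hull_int r y : paramodular r -> gpoly r y ->
    fibers_int (ext y) (hull (mem (tight_family r y))).
  move=> rP yr; apply: (fibers_hull_int (tight_family0 r y) (tight_familyT r y)).
  - by move=> A B AF BF; case: (tight_familyUI rP yr AF BF).
  - by move=> A B AF BF; case: (tight_familyUI rP yr AF BF).
  - exact: tight_family_int.
(* As [w] is integral, fiber sums of [x] are integral whenever those of [w - x] are. *)
have qx : fibers_int (ext x) (hull (mem (tight_family q (w - x)))).
  move=> C; have := hull_int q (w - x) qP xq C.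
  move=> subZ.
  have -> : \sum_(t | hull (mem (tight_family q (w - x))) t == C) ext x t =
      \sum_(t | hull (mem (tight_family q (w - x))) t == C) ext w t -
      \sum_(t | hull (mem (tight_family q (w - x))) t == C) ext (w - x) t.
    rewrite -sumrB; apply: eq_bigr => -[e|] _ /=.
      by rewrite !ffunE opprB addrC subrK.
    by rewrite vsumB; lra.
  rewrite rpredB // rpred_sum // => -[e|] _ /=; first exact: wZ.
  by rewrite rpredN vsum_int.
have [|d [[t dt] dZ dp dq]] :=
  fractional_circulation (t0 := Some e0) (hull_int p x pP xp) qx.
  by rewrite inE.
pose d' : {ffun E -> R^o} := [ffun e => d (Some e)].
(* The full set is in the tight family, so [d] has total zero and its value at [None] is the one
   [ext] prescribes. *)
have d_ext s : d s = ext d' s.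
  case: s => [e|] /=; first by rewrite ffunE.
  have := sum_lattice0 dp (tight_familyT p x).
  rewrite (eq_bigl xpredT) => [|s]; last by rewrite inE.
  rewrite big_option => /eqP; rewrite addr_eq0 => /eqP ->; congr (- _).
  by apply: eq_big => e; rewrite ?inE ?ffunE.
have dir r y : (forall C, \sum_(t | hull (mem (tight_family r y)) t == C) d t = 0) ->
    tight_dir r y d'.
  move=> dr U.
  have sum0 A : A \in tight_family r y -> \sum_(t in A) ext d' t = 0.
    move=> AF; rewrite -[RHS](sum_lattice0 dr AF).
    by apply: eq_bigr => s _; rewrite d_ext.
  split=> [tU|b tU].
    have := sum0 (Some @: U); rewrite sum_ext.
    have NU : None \notin Some @: U by apply/imsetP => -[].
    have preU : Some @^-1: (Some @: U) = U.
      by apply/setP => e; rewrite inE mem_imset // => ? ? [].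
    rewrite (negbTE NU) preU; apply.
    by apply/tight_familyP; constructor 3; rewrite preU.
  have := sum0 (~: (Some @: U)); rewrite sum_ext.
  have NU : None \in ~: (Some @: U) by rewrite inE; apply/imsetP => -[].
  have preU : ~: (Some @^-1: ~: (Some @: U)) = U.
    by apply/setP => e; rewrite !inE negbK mem_imset // => ? ? [].
  rewrite NU preU => H; apply/eqP; rewrite -oppr_eq0; apply/eqP/H.
  by apply/tight_familyP; constructor 4; rewrite preU.
exists d'; split.
- apply: contra_neq dt => d0; rewrite d_ext d0.
  by case: t => [e|] /=; rewrite ?ffunE // vsum0 oppr0.
- by move=> e xe; rewrite ffunE dZ.
- exact: dir.
- exact: dir.
Qed.

End GeneralizedPolymatroid.

(** * Integral vertices of intersections of boxed generalized polymatroids *)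

Section IntegralVertex.
Variables (R : realType) (E : finType).
Implicit Types (p q : gpm E) (c u : E -> int) (x y z d w : {ffun E -> R^o}).

Definition boxed p c u x : Prop :=
  gpoly p x /\ forall e, (c e)%:~R <= x e <= (u e)%:~R.

Definition boxed_dir p c u x d : Prop :=
  tight_dir p x d /\
  forall e, (x e = (c e)%:~R -> d e = 0) /\ (x e = (u e)%:~R -> d e = 0).

(** Treats set sums and single coordinates alike, so that all bounds form one system. *)
Definition coord_sum (x : {ffun E -> R^o}) (s : {set E} + E) : R :=
  match s with inl U => vsum x U | inr e => x e end.

Definition upper p u (s : {set E} + E) : R :=
  match s with inl U => (up p U)%:~R | inr e => (u e)%:~R end.

Definition lower p c (s : {set E} + E) : R :=
  match s with inl U => (lo p U)%:~R | inr e => (c e)%:~R end.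

Definition bounded_below p (s : {set E} + E) : bool :=
  if s is inl _ then bd p else true.

Lemma coord_sumD x t d s : coord_sum (x + t *: d) s = coord_sum x s + t * coord_sum d s.
Proof. by case: s => [U|e] /=; rewrite ?vsumD ?vsumZ // !ffunE. Qed.

Lemma coord_sumB x y s : coord_sum (x - y) s = coord_sum x s - coord_sum y s.
Proof. by case: s => [U|e] /=; rewrite ?vsumB // !ffunE. Qed.

Lemma boxedP p c u x :
  boxed p c u x <->
  forall s, coord_sum x s <= upper p u s /\
            (bounded_below p s -> lower p c s <= coord_sum x s).
Proof.
split=> [[xp xb] [U|e] /=|H]; first exact: xp.
  by have /andP[] := xb e.
split=> [U|e]; first exact: (H (inl U)).
by have [/= -> ->] := H (inr e).
Qed.

Lemma boxed_dirP p c u x d :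
  boxed_dir p c u x d <->
  forall s, (coord_sum x s = upper p u s -> coord_sum d s = 0) /\
     (bounded_below p s -> coord_sum x s = lower p c s -> coord_sum d s = 0).
Proof.
split=> [[xp xb] [U|e] /=|H]; first exact: xp.
  by have [] := xb e.
split=> [U|e]; first exact: (H (inl U)).
by have [/= ? ?] := H (inr e); split=> // /[dup]; auto.
Qed.

(** A fractional coordinate of the vertex [y] would yield a nonzero direction preserving all tight
    sets. It vanishes on integral coordinates, so it preserves the tight box bounds too, against the
    last clause. *)
Lemma integral_vertex p q w c1 u1 c2 u2 x0 :
  paramodular p -> paramodular q -> integral_vector w ->
  boxed p c1 u1 x0 -> boxed q c2 u2 (w - x0) ->
  exists y,
    [/\ integral_vector y, boxed p c1 u1 y, boxed q c2 u2 (w - y),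
        forall a : E -> R,
          (forall z, boxed p c1 u1 z -> boxed q c2 u2 (w - z) ->
             dotp a z <= dotp a x0) -> dotp a y = dotp a x0
      & forall d, boxed_dir p c1 u1 y d -> boxed_dir q c2 u2 (w - y) d -> d = 0].
Proof.
move=> pP qP wZ xp xq.
(* [side] tells constraints on [w - x] from those on [x], and [low] tells lower from upper bounds.
   Each of the two reverses the sign of the constraint on [x]. *)
pose J := (bool * bool * ({set E} + E))%type.
pose act (j : J) := let: (side, low, s) := j in
  low ==> bounded_below (if side then q else p) s.
pose phi (j : J) x := let: (side, low, s) := j in
  if side (+) low then - coord_sum x s else coord_sum x s.
pose b (j : J) := let: (side, low, s) := j in
  match side, low with
  | false, false => upper p u1 s
  | false, true => - lower p c1 s
  | true, false => upper q u2 s - coord_sum w s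
  | true, true => coord_sum w s - lower q c2 s
  end.
have phi_affine j x t d : phi j (x + t *: d) = phi j x + t * phi j d.
  by case: j => [[[] []] s]; rewrite /= coord_sumD //; lra.
have feasP x : feasible act phi b x <-> boxed p c1 u1 x /\ boxed q c2 u2 (w - x).
  split=> [xf|[/boxedP xP /boxedP xQ] [[[] []] s] /=].
  - split; apply/boxedP => s; split.
    + exact: (xf (false, false, s) isT).
    + by move=> bs; have := xf (false, true, s) bs; rewrite /= lerN2.
    + by have := xf (true, false, s) isT; rewrite /= coord_sumB; lra.
    + by move=> bs; have := xf (true, true, s) bs; rewrite /= coord_sumB; lra.
  - by move=> bs; have [_ /(_ bs)] := xQ s; rewrite coord_sumB; lra.
  - by have [+ _] := xQ s; rewrite coord_sumB; lra.
  - by move=> bs; have [_ /(_ bs)] := xP s; lra.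
  - by have [+ _] := xP s.
have tightP x d : boxed_dir p c1 u1 x d -> boxed_dir q c2 u2 (w - x) d ->
    forall j, j \in tight act phi b x -> phi j d = 0.
  move=> /boxed_dirP dP /boxed_dirP dQ [[[] []] s]; rewrite inE => /andP[] /=.
  - by move=> bs /eqP t; have [_ h] := dQ s; apply: h => //; rewrite coord_sumB; lra.
  - move=> _ /eqP t; have [h _] := dQ s; rewrite h ?oppr0 //.
    by rewrite coord_sumB; lra.
  - by move=> bs /eqP t; have [_ h] := dP s; rewrite h ?oppr0 //; lra.
  - by move=> _ /eqP t; have [h _] := dP s; apply: h.
have [|y [/feasP[yp yq] yface ystuck]] := @vertex_exists _ _ _ act _ b phi_affine x0.
  exact/feasP.
have stuck d : boxed_dir p c1 u1 y d -> boxed_dir q c2 u2 (w - y) d -> d = 0.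
  move=> dp dq; apply/ffunP => e; rewrite ffunE.
  exact: (ystuck d (tightP _ _ dp dq) (false, false, inr e)).
exists y; split=> //; last first.
  move=> a amax.
  apply: (yface (fun z : {ffun E -> R^o} => dotp a z)) => [z t d|z /feasP[]];
    last exact: amax.
  rewrite /dotp mulr_sumr -big_split; apply: eq_bigr => e _ /=.
  by rewrite !ffunE mulrDr mulrCA.
apply: contrapT => /existsNP[e0 /negP ye0].
have [d [d0 dZ dp dq]] := fractional_direction pP qP wZ yp.1 yq.1 ye0.
case/eqP: d0; apply: stuck; split=> // e; split=> ye; apply: dZ.
- by rewrite ye intr_int.
- by rewrite ye intr_int.
- have -> : y e = w e - (w - y) e by rewrite !ffunE opprB addrC subrK.
  by rewrite ye rpredB ?intr_int.
- have -> : y e = w e - (w - y) e by rewrite !ffunE opprB addrC subrK.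
  by rewrite ye rpredB ?intr_int.
Qed.

End IntegralVertex.

(** * Integer decomposition and the integer Caratheodory property *)

Section Caratheodory.
Variables (R : realType) (E : finType) (p : gpm E).
Hypothesis p_paramodular : paramodular p.
Implicit Types (c u : E -> int) (x y z d w : {ffun E -> R^o}).

(** The bounds are scaled rather than the set: at [n = 0] exactly the origin remains. *)
Definition multiple (n : nat) c u x : Prop :=
  boxed (gpm_scale n p) (fun e => c e *+ n) (fun e => u e *+ n) x.

Lemma upper_scale n u s :
  upper R (gpm_scale n p) (fun e => u e *+ n) s = n%:R * upper R p u s.
Proof. by case: s => [U|e] /=; rewrite rmorphMn mulr_natl. Qed.

Lemma lower_scale n c s :
  lower R (gpm_scale n p) (fun e => c e *+ n) s = n%:R * lower R p c s.
Proof. by case: s => [U|e] /=; rewrite rmorphMn mulr_natl. Qed.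

Lemma multipleP n c u x :
  multiple n c u x <->
  forall s, coord_sum x s <= n%:R * upper R p u s /\
            (bounded_below p s -> n%:R * lower R p c s <= coord_sum x s).
Proof.
rewrite /multiple boxedP; split=> H s; have := H s;
  by rewrite upper_scale lower_scale; case: s.
Qed.

Lemma multiple1 c u x : multiple 1 c u x <-> boxed p c u x.
Proof. by rewrite multipleP boxedP; split=> H s; have := H s; rewrite !mul1r. Qed.

Lemma multipleD m n c u x y :
  multiple m c u x -> multiple n c u y -> multiple (m + n) c u (x + y).
Proof.
move=> /multipleP xm /multipleP yn; apply/multipleP => s.
have [xu xl] := xm s; have [yu yl] := yn s.
rewrite -[y]scale1r coord_sumD natrD; split; first lra.
by move=> bs; have := xl bs; have := yl bs; lra.
Qed.

Lemma multipleZ m n c u x : (0 < m)%N ->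
  multiple m c u x -> multiple n c u ((n%:R / m%:R) *: x).
Proof.
move=> m0 /multipleP xm; apply/multipleP => s; have [xu xl] := xm s.
have coordZ : coord_sum ((n%:R / m%:R) *: x) s = n%:R / m%:R * coord_sum x s.
  have := coord_sumD 0 (n%:R / m%:R) x s; rewrite add0r => ->.
  by case: s {xu xl} => [U|e] /=; rewrite ?vsum0 ?ffunE add0r.
have m0R : (0 : R) < m%:R by rewrite ltr0n.
have mul (t : R) : n%:R * t = n%:R / m%:R * (m%:R * t).
  by rewrite mulrA divfK ?gt_eqF.
have nm0 : (0 : R) <= n%:R / m%:R by rewrite divr_ge0 ?ler0n.
rewrite coordZ (mul (upper R p u s)) (mul (lower R p c s)).
by split=> [|/xl]; apply: ler_wpM2l.
Qed.

Lemma multiple0 c u : multiple 0 c u 0.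
Proof.
by apply/multipleP => -[U|e] /=; rewrite ?vsum0 ?ffunE !mul0r lexx.
Qed.

Lemma multiple_sum c u (s : seq {ffun E -> R^o}) :
  (forall x, x \in s -> boxed p c u x) -> multiple (size s) c u (\sum_(x <- s) x).
Proof.
elim: s => [_|x s IHs xs]; first by rewrite big_nil; apply: multiple0.
rewrite big_cons /= -add1n; apply: multipleD.
  by apply/multiple1/xs; rewrite mem_head.
by apply: IHs => y ys; apply: xs; rewrite inE ys orbT.
Qed.

(** Scaling [w] gives a real splitting into one point and a [k]-fold part; [integral_vertex] makes
    it integral, and induction decomposes the second part. *)
Lemma integer_decomposition k c u w : integral_vector w -> multiple k c u w ->
  exists s : seq {ffun E -> R^o},
    [/\ size s = k, w = \sum_(x <- s) x
      & forall x, x \in s -> integral_vector x /\ boxed p c u x].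
Proof.
elim: k w => [|k IHk] w wZ wk.
  exists [::]; split=> //; rewrite big_nil; apply/ffunP => e; rewrite ffunE.
  have /multipleP/(_ (inr e)) [/= + /(_ isT)] := wk.
  by rewrite !mul0r => le0 ge0; apply/eqP; rewrite eq_le le0.
have k0 : (0 : R) < k.+1%:R by rewrite ltr0n.
pose x0 := (1%:R / k.+1%:R : R) *: w.
have x0_box : boxed p c u x0 by apply/multiple1; apply: multipleZ.
have wx0 : multiple k c u (w - x0).
  have -> : w - x0 = (k%:R / k.+1%:R) *: w.
    rewrite /x0 -{1}[w]scale1r -scalerBl; congr (_ *: _).
    by rewrite -{1}(@divff _ k.+1%:R) ?gt_eqF // -mulrBl -natrB // subn1.
  exact: multipleZ.
have [y [yZ yb yk _ _]] :=
  integral_vertex p_paramodular (paramodular_scale k p_paramodular) wZ x0_box wx0.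
have [|s [sk ws sP]] := IHk (w - y) _ yk.
  by move=> e; rewrite !ffunE rpredB.
exists (y :: s); split; rewrite /= ?sk //.
  by rewrite big_cons -ws addrC subrK.
by move=> x; rewrite inE => /predU1P[->|/sP].
Qed.

Lemma boxed_sub c u c' u' x :
  (forall e, c e <= c' e) -> (forall e, u' e <= u e) ->
  boxed p c' u' x -> boxed p c u x.
Proof.
move=> cc' u'u [xp xb]; split=> // e; have /andP[cx xu] := xb e.
by rewrite (le_trans _ cx) ?(le_trans xu) ?ler_int.
Qed.

(** A constraint tight at a positive combination is tight at every [x i], hence takes one value on
    all of them, and coefficients of sum zero cancel it. *)
Lemma positive_combination_dir (t : nat) (m : 'I_t -> nat)
    (x : 'I_t -> {ffun E -> R^o}) (l : 'I_t -> R) c u :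
  (forall i, boxed p c u (x i)) -> (forall i, (0 < m i)%N) -> \sum_i l i = 0 ->
  boxed_dir (gpm_scale (\sum_i m i) p)
    (fun e => c e *+ (\sum_i m i)%N) (fun e => u e *+ (\sum_i m i)%N)
    (\sum_i (m i)%:R *: x i) (\sum_i l i *: x i).
Proof.
move=> xb m0 l0; apply/boxed_dirP => s.
rewrite upper_scale lower_scale.
have sumE (n : 'I_t -> R) :
    coord_sum (\sum_i n i *: x i) s = \sum_i n i * coord_sum (x i) s.
  case: s => [U|e] /=; first exact: vsum_sum.
  by rewrite sum_ffunE; apply: eq_bigr => i _; rewrite ffunE.
have const (b : R) :
    (forall i, coord_sum (x i) s = b) -> \sum_i l i * coord_sum (x i) s = 0.
  by move=> xB; rewrite (eq_bigr (fun i => l i * b)) => [|i _];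
    rewrite ?xB // -mulr_suml l0 mul0r.
have gaps0 (h : 'I_t -> R) : (forall i, 0 <= h i) -> \sum_i (m i)%:R * h i = 0 ->
    forall i, h i = 0.
  move=> h0 sum0 i; have mh0 j : true -> 0 <= (m j)%:R * h j by rewrite mulr_ge0.
  have /eqP : (m i)%:R * h i = 0 by apply: psumr_eq0P mh0 sum0 _ _.
  by rewrite mulf_eq0 pnatr_eq0 gtn_eqF //= => /eqP.
rewrite !sumE natr_sum !mulr_suml; split=> [eq_up|bs eq_lo]; apply: const => i;
  apply/esym/eqP; rewrite -subr_eq0; apply/eqP.
  apply: (gaps0 (fun i => upper R p u s - coord_sum (x i) s)) => [j|].
    by rewrite subr_ge0; have /boxedP/(_ s)[] := xb j.
  under eq_bigr do rewrite mulrBr.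
  by rewrite sumrB eq_up subrr.
rewrite -[RHS]oppr0 -opprB; congr (- _).
apply: (gaps0 (fun i => coord_sum (x i) s - lower R p c s)) => [j|].
  by rewrite subr_ge0; have /boxedP/(_ s)[_ /(_ bs)] := xb j.
under eq_bigr do rewrite mulrBr.
by rewrite sumrB eq_lo subrr.
Qed.

(** Multiplicities are positive, unlike in [integer_caratheodory], so that
    [positive_combination_dir] applies. *)
Definition caratheodory_decomposition (k : nat) c u w : Prop :=
  exists (t : nat) (x : 'I_t -> {ffun E -> R^o}) (m : 'I_t -> nat),
    [/\ affinely_independent x,
        forall i, boxed p c u (x i) /\ integral_vector (x i),
        forall i, (0 < m i)%N, (\sum_i m i)%N = k
      & w = \sum_i (m i)%:R *: x i].

Lemma caratheodory_singleton k c w : (0 < k)%N -> multiple k c c w ->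
  caratheodory_decomposition k c c w.
Proof.
move=> k0 wk; have k0R : (k%:R : R) != 0 by rewrite pnatr_eq0 -lt0n.
have xb : boxed p c c ((1%:R / k%:R : R) *: w).
  by apply/multiple1; apply: multipleZ.
exists 1%N, (fun=> (1%:R / k%:R : R) *: w), (fun=> k); split=> //.
- by move=> l; rewrite big_ord1 => l0 _ i; rewrite ord1.
- move=> _; split=> // e; have /andP[cx xc] := xb.2 e.
  by have -> : ((1%:R / k%:R : R) *: w) e = (c e)%:~R;
    [apply/eqP; rewrite eq_le xc cx | rewrite intr_int].
- by rewrite big_ord1.
- by rewrite big_ord1 scalerA mulrCA divff // mulr1 scale1r.
Qed.

Definition set_at c (e : E) (a : int) : E -> int :=
  fun i => if i == e then a else c i.

(** Group the terms of an integer decomposition by their value at [e], which is [u e] or [c e]. *)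
Lemma split_at k c u w e : integral_vector w -> multiple k c u w ->
  u e = c e + 1 ->
  exists r w1, [/\ (r <= k)%N, multiple r (set_at c e (u e)) u w1
    & multiple (k - r) c (set_at u e (c e)) (w - w1)].
Proof.
move=> wZ wk ue; have [s [sk ws sP]] := integer_decomposition wZ wk.
pose P := [pred x : {ffun E -> R^o} | x e == (u e)%:~R].
exists (size (seq.filter P s)), (\sum_(x <- seq.filter P s) x); split.
- by rewrite size_filter -sk count_size.
- apply: multiple_sum => x; rewrite mem_filter => /andP[/eqP xe /sP[_ [xp xb]]].
  split=> // i; rewrite /set_at; case: eqP => [->|_]; last exact: xb.
  by rewrite xe lexx.
have -> : (k - size (seq.filter P s))%N = size (seq.filter (predC P) s).
  by rewrite !size_filter -sk -(count_predC P) addKn.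
have -> : w - \sum_(x <- seq.filter P s) x = \sum_(x <- seq.filter (predC P) s) x.
  by rewrite ws !big_filter (bigID P) /= addrAC subrr add0r.
apply: multiple_sum => x; rewrite mem_filter => /andP[/= xe /sP[xZ [xp xb]]].
split=> // i; rewrite /set_at; case: eqP => [->|_]; last exact: xb.
have /andP[cx xu] := xb e; rewrite cx /=.
have /intrP[a xa] := xZ e; move: xe cx xu.
by rewrite xa ue eqr_int !ler_int; lia.
Qed.

(* Choosing the splitting [w = y + (w - y)] at a vertex of the intersection   *)
(* makes the direction spaces of the minimal faces of the two parts           *)
(* independent.                                                               *)
Lemma caratheodory_join k r c u w w1 e : integral_vector w -> u e = c e + 1 ->
  (0 < r)%N -> (r < k)%N ->
  multiple r (set_at c e (u e)) u w1 ->
  multiple (k - r) c (set_at u e (c e)) (w - w1) ->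
  (forall y, integral_vector y -> multiple r (set_at c e (u e)) u y ->
     caratheodory_decomposition r (set_at c e (u e)) u y) ->
  (forall y, integral_vector y -> multiple (k - r) c (set_at u e (c e)) y ->
     caratheodory_decomposition (k - r) c (set_at u e (c e)) y) ->
  caratheodory_decomposition k c u w.
Proof.
move=> wZ ue r0 rk w1P w2P IH1 IH2.
have [y [yZ y1 y2 _ stuck]] := integral_vertex
  (paramodular_scale r p_paramodular) (paramodular_scale (k - r) p_paramodular)
  wZ w1P w2P.
have wyZ : integral_vector (w - y) by move=> i; rewrite !ffunE rpredB.
have [t1 [x1 [m1 [ind1 x1P m1_gt0 m1r yE]]]] := IH1 _ yZ y1.
have [t2 [x2 [m2 [ind2 x2P m2_gt0 m2r wyE]]]] := IH2 _ wyZ y2.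
exists (t1 + t2)%N,
  (fun i => match fintype.split i with inl a => x1 a | inr b => x2 b end),
  (fun i => match fintype.split i with inl a => m1 a | inr b => m2 b end).
have splitl i : fintype.split (lshift t2 i) = inl i by exact: (unsplitK (inl i)).
have splitr i : fintype.split (rshift t1 i) = inr i by exact: (unsplitK (inr i)).
split.
- move=> l; rewrite !big_split_ord /=.
  under [X in _ -> X + _ = _ -> _]eq_bigr do rewrite splitl.
  under [X in _ -> _ + X = _ -> _]eq_bigr do rewrite splitr.
  set l1 := fun i => l (lshift t2 i); set l2 := fun i => l (rshift t1 i).
  rewrite -/(l1 _) -/(l2 _) => sum_l sum_lx.
  have x1e i : x1 i e = (u e)%:~R.
    have [[_ /(_ e)] + _] := x1P i; rewrite /set_at eqxx => /andP[cx xu].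
    by apply/eqP; rewrite eq_le cx xu.
  have x2e i : x2 i e = (c e)%:~R.
    have [[_ /(_ e)] + _] := x2P i; rewrite /set_at eqxx => /andP[cx xu].
    by apply/eqP; rewrite eq_le cx xu.
  (* Coordinate [e] is constant on each family and the two values differ by 1, so with total zero
     both coefficient sums vanish. *)
  have sum1 : \sum_i l1 i = 0.
    have := congr1 (fun z : {ffun E -> R^o} => z e) sum_lx.
    rewrite !ffunE !sum_ffunE.
    rewrite (eq_bigr (fun i => l1 i * (u e)%:~R)); last by move=> i _; rewrite ffunE x1e.
    rewrite [X in _ + X](eq_bigr (fun i => l2 i * (c e)%:~R)); last first.
      by move=> i _; rewrite ffunE x2e.
    rewrite -!mulr_suml ue rmorphD /= => eq0; move: sum_l eq0.
    rewrite -/(\sum_i l1 i); nra.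
  have sum2 : \sum_i l2 i = 0 by move: sum_l; rewrite sum1 add0r.
  (* This vector is, up to sign, a combination of either family, so it preserves the tight
     constraints of both parts and vanishes by the choice of [y]. *)
  have d0 : \sum_i l1 i *: x1 i = 0.
    apply: stuck.
      rewrite yE -m1r; apply: positive_combination_dir => // i.
      by have [] := x1P i.
    have -> : \sum_i l1 i *: x1 i = \sum_i (- l2 i) *: x2 i.
      under [RHS]eq_bigr do rewrite scaleNr.
      by rewrite sumrN; apply/eqP; rewrite -addr_eq0 sum_lx.
    rewrite wyE -m2r; apply: positive_combination_dir => // [i|].
      by have [] := x2P i.
    by rewrite sumrN sum2 oppr0.
  have d20 : \sum_i l2 i *: x2 i = 0 by move: sum_lx; rewrite d0 add0r.
  move=> i; rewrite -(splitK i); case: (fintype.split i) => a /=.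
    exact: ind1 sum1 d0 a.
  exact: ind2 sum2 d20 a.
- move=> i; case: (fintype.split i) => a.
    have [xb xZ] := x1P a; split=> //; apply: boxed_sub xb => // j.
    by rewrite /set_at; case: eqP => [->|//]; rewrite ue lerDl.
  have [xb xZ] := x2P a; split=> //; apply: boxed_sub xb => // j.
  by rewrite /set_at; case: eqP => [->|//]; rewrite ue lerDl.
- by move=> i; case: (fintype.split i).
- rewrite big_split_ord /=.
  under eq_bigr do rewrite splitl.
  under [X in (_ + X)%N]eq_bigr do rewrite splitr.
  by rewrite m1r m2r subnKC // ltnW.
- rewrite big_split_ord /=.
  under eq_bigr do rewrite splitl.
  under [X in _ = _ + X]eq_bigr do rewrite splitr.
  by rewrite -yE -wyE addrC subrK.
Qed.

(** Induction on the number of coordinates with [c e != u e]. If [r = 0] or [r = k], the whole of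
    [w] belongs to one face; otherwise the two parts are joined. *)
Lemma caratheodory_boxed k c u w : (0 < k)%N -> integral_vector w ->
  (forall e, c e <= u e <= c e + 1) -> multiple k c u w ->
  caratheodory_decomposition k c u w.
Proof.
have [n] := ubnP #|[set e | c e != u e]|.
elim: n k c u w => // n IHn k c u w ltn k0 wZ cu wk.
have [e ce|none] := pickP [pred e | c e != u e]; last first.
  have cuE : c = u by apply/funext => e; have /negbT := none e; rewrite negbK => /eqP.
  by subst u; apply: caratheodory_singleton.
have ue : u e = c e + 1 by have := cu e; move: ce; rewrite /=; lia.
have free_lt c' u' : c' e = u' e -> (forall i, i != e -> c' i = c i) ->
    (forall i, i != e -> u' i = u i) -> (#|[set i | c' i != u' i]| < n)%N.
  move=> e' c'E u'E; rewrite -ltnS; apply: leq_trans ltn; rewrite ltnS.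
  apply: proper_card.
  apply/properP; split.
    apply/fintype.subsetP => i; rewrite !inE.
    by have [->|ie] := eqVneq i e; rewrite ?e' ?eqxx // c'E // u'E.
  by exists e; rewrite inE ?e' ?eqxx.
have lt1 : (#|[set i | set_at c e (u e) i != u i]| < n)%N.
  by apply: free_lt => //; rewrite /set_at ?eqxx // => i /negbTE->.
have lt2 : (#|[set i | c i != set_at u e (c e) i]| < n)%N.
  by apply: free_lt => //; rewrite /set_at ?eqxx // => i /negbTE->.
have cu1 i : set_at c e (u e) i <= u i <= set_at c e (u e) i + 1.
  by rewrite /set_at; case: eqP => [->|_]; rewrite ?lexx ?lerDl.
have cu2 i : c i <= set_at u e (c e) i <= c i + 1.
  by rewrite /set_at; case: eqP => [->|_]; rewrite ?lexx ?lerDl.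
have [r [w1 [rk w1P w2P]]] := split_at wZ wk ue.
have [r0|r0] := posnP r.
  have : caratheodory_decomposition k c (set_at u e (c e)) w.
    apply: IHn => //; move: w1P w2P; rewrite r0 subn0 => /multipleP w10.
    suff -> : w1 = 0 by rewrite subr0.
    apply/ffunP => i; have := w10 (inr i); rewrite /= !mul0r ffunE.
    by case=> le0 /(_ isT) ge0; apply/eqP; rewrite eq_le le0.
  case=> t [x [m [ind xP m0 mk wE]]]; exists t, x, m; split=> // i.
  have [xb xZ] := xP i; split=> //; apply: boxed_sub xb => // j.
  by rewrite /set_at; case: eqP => [->|//]; rewrite ue lerDl.
have [rk'|kr] := ltnP r k.
  by apply: (caratheodory_join wZ ue r0 rk' w1P w2P) => y yZ yP; apply: IHn;
    rewrite ?subn_gt0.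
have {kr} rE : r = k by apply/eqP; rewrite eqn_leq rk.
have : caratheodory_decomposition k (set_at c e (u e)) u w.
  apply: IHn => //; move: w2P w1P; rewrite rE subnn => /multipleP w20.
  suff -> : w = w1 by [].
  apply/ffunP => i; have := w20 (inr i); rewrite /= !mul0r !ffunE.
  case=> le0 /(_ isT) ge0; apply/eqP; rewrite -subr_eq0 eq_le; exact/andP.
case=> t [x [m [ind xP m0 mk wE]]]; exists t, x, m; split=> // i.
have [xb xZ] := xP i; split=> //; apply: boxed_sub xb => // j.
by rewrite /set_at; case: eqP => [->|//]; rewrite ue lerDl.
Qed.

Lemma caratheodory_gpoly k x : (0 < k)%N -> integral_vector (k%:R *: x) ->
  gpoly p x ->
  exists (t : nat) (y : 'I_t -> {ffun E -> R^o}) (m : 'I_t -> nat),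
    [/\ affinely_independent y,
        (forall i, gpoly p (y i) /\ integral_vector (y i)),
        (\sum_i m i)%N = k
      & k%:R *: x = \sum_i (m i)%:R *: y i].
Proof.
(* The unit integer box with lower corner [c] contains [x]. *)
move=> k0 kxZ xp; pose c e := Num.floor (x e).
have [||t [y [m [ind yP _ mk yE]]]] :=
  @caratheodory_boxed k c (fun e => c e + 1) (k%:R *: x) k0 kxZ.
- by move=> e; rewrite lerDl lexx.
- have -> : k%:R *: x = (k%:R / 1%:R : R) *: x by rewrite divr1.
  apply: multipleZ => //.
  apply/multiple1; split=> // e.
  by rewrite floor_le ltW ?floorD1_gt.
exists t, y, m; split=> // i; have [[yp _] yZ] := yP i; by split.
Qed.

End Caratheodory.

Local Open Scope classical_set_scope.
Local Open Scope ring_scope.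

(** * Polyhedra and box-integrality *)

Section PolyhedronConstructions.
Variables (R : realType) (I : finType).
Implicit Types (P Q : set {ffun I -> R^o}) (x w : {ffun I -> R^o}).

Lemma rational_polyhedron_fin (J : finType) (A : J -> I -> rat) (b : J -> rat) :
  is_rational_polyhedron
    [set x : {ffun I -> R^o} | forall j, dotp (fun i => ratr (A j i)) x <= ratr (b j)].
Proof.
exists #|J|, (fun j => A (enum_val j)), (fun j => b (enum_val j)).
apply/seteqP; split=> x xP j /=; first exact: xP.
by have := xP (enum_rank j); rewrite enum_rankK.
Qed.

Lemma polyhedron_fin (J : finType) (A : J -> I -> R) (b : J -> R) :
  is_polyhedron [set x : {ffun I -> R^o} | forall j, dotp (A j) x <= b j].
Proof.
exists #|J|, (fun j => A (enum_val j)), (fun j => b (enum_val j)).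
apply/seteqP; split=> x xP j /=; first exact: xP.
by have := xP (enum_rank j); rewrite enum_rankK.
Qed.

Lemma rational_polyhedron_polyhedron P : is_rational_polyhedron P -> is_polyhedron P.
Proof. by case=> m [A [b ->]]; apply: polyhedron_fin. Qed.

Lemma polyhedronI P Q : is_polyhedron P -> is_polyhedron Q -> is_polyhedron (P `&` Q).
Proof.
move=> [m [A [a ->]]] [n [B [b ->]]].
pose AB (j : 'I_m + 'I_n) := match j with inl i => A i | inr i => B i end.
pose ab (j : 'I_m + 'I_n) := match j with inl i => a i | inr i => b i end.
have -> : [set x : {ffun I -> R^o} | forall j, dotp (A j) x <= a j] `&`
    [set x : {ffun I -> R^o} | forall j, dotp (B j) x <= b j] =
    [set x : {ffun I -> R^o} | forall j, dotp (AB j) x <= ab j].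
  apply/seteqP; split=> x; first by move=> [xA xB] [j|j]; [apply: xA|apply: xB].
  by move=> xP; split=> j; [apply: (xP (inl j))|apply: (xP (inr j))].
exact: polyhedron_fin.
Qed.

Lemma dotp_indicator (s : R) (U : {set I}) x :
  dotp (fun i => s * (i \in U)%:R) x = s * vsum x U.
Proof.
rewrite /dotp /vsum mulr_sumr [RHS]big_mkcond; apply: eq_bigr => i _.
by case: (i \in U); rewrite ?mulr1 // mulr0 mul0r.
Qed.

Lemma polyhedron_reflect w P :
  is_polyhedron P -> is_polyhedron [set x | P (w - x)].
Proof.
case=> m [A [b ->]].
have -> : [set x | [set y : {ffun I -> R^o} | forall j, dotp (A j) y <= b j] (w - x)] =
   [set x : {ffun I -> R^o} |
     forall j, dotp (fun i => - A j i) x <= b j - dotp (A j) w].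
  have dotpB j x : dotp (A j) (w - x) = dotp (A j) w + dotp (fun i => - A j i) x.
    rewrite /dotp -big_split; apply: eq_bigr => i _ /=.
    by rewrite !ffunE mulrBr mulNr.
  by apply/seteqP; split=> x xP j /=; have := xP j; rewrite /= dotpB; lra.
exact: polyhedron_fin.
Qed.

Lemma polyhedron_box (c d : I -> \bar int) :
  is_polyhedron (box c d : set {ffun I -> R^o}).
Proof.
(* An infinite bound becomes a zero row: [0 <= 0] if it always holds, [0 <= -1] if it cannot be
   met. *)
pose s (j : I * bool) : R :=
  match (if j.2 then d j.1 else c j.1) with
  | EFin _ => if j.2 then 1 else -1 | _ => 0 end.
pose b (j : I * bool) : R :=
  match (if j.2 then d j.1 else c j.1) with
  | EFin a => if j.2 then a%:~R else - a%:~R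
  | EPInf => if j.2 then 0 else -1 | ENInf => if j.2 then -1 else 0 end.
have -> : box c d =
    [set x : {ffun I -> R^o} |
      forall j, dotp (fun i => s j * (i \in [set j.1]%SET)%:R) x <= b j].
  apply/seteqP; split=> x xP.
    move=> [i up]; rewrite dotp_indicator vsum1 /s /b /=; have := xP i.
    by case: up; case: (c i) (d i) => [c'| |] [d'| |] [] //=; rewrite ?lee_fin; lra.
  move=> i; have := xP (i, true); have := xP (i, false).
  rewrite !dotp_indicator !vsum1 /s /b /=.
  by case: (c i) (d i) => [c'| |] [d'| |] /= lo_i up_i;
    first [by exfalso; lra | split; rewrite ?lee_fin ?leey ?leNye //; lra].
exact: polyhedron_fin.
Qed.

Lemma polyhedron0 : is_polyhedron (set0 : set {ffun I -> R^o}).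
Proof.
have -> : set0 = [set x : {ffun I -> R^o} |
    forall j : unit, dotp (fun i => 0 * (i \in [set: I]%SET)%:R) x <= -1].
  by apply/seteqP; split=> x // /(_ tt); rewrite dotp_indicator; lra.
exact: polyhedron_fin.
Qed.

Lemma polyhedron1 x : is_polyhedron [set x].
Proof.
pose s (j : I * bool) : R := if j.2 then 1 else -1.
have -> : [set x] = [set y : {ffun I -> R^o} |
    forall j, dotp (fun i => s j * (i \in [set j.1]%SET)%:R) y <= s j * x j.1].
  apply/seteqP; split=> y; first by move=> -> j /=; rewrite dotp_indicator vsum1.
  move=> yP; apply/ffunP => i; have := yP (i, true); have := yP (i, false).
  by rewrite !dotp_indicator !vsum1 /s /=; lra.
exact: polyhedron_fin.
Qed.

(** Covers [r = 0] and [r = k], where one of the two sets is dilated by 0. *)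
Lemma box_integer_subsingleton x Q :
  integral_vector x -> Q `<=` [set x] -> box_integer Q.
Proof.
move=> xZ Qx.
have polyQ : is_polyhedron Q.
  have [xQ|nxQ] := pselect (Q x).
    rewrite (_ : Q = [set x]); first exact: polyhedron1.
    by apply/seteqP; split=> // y ->.
  rewrite (_ : Q = set0); first exact: polyhedron0.
  by apply/seteqP; split=> // y yQ; apply: nxQ; rewrite -(Qx _ yQ).
split=> // c d _; split; first exact/polyhedronI/polyhedron_box.
move=> F [a [delta [_ ->]]] [y [[yQ yb] ay]].
by exists y => //; rewrite (Qx _ yQ).
Qed.

Lemma reflect_dilateE w (t : R) P :
  reflect_dilate w t P = [set x | dilate t P (w - x)].
Proof.
apply/seteqP; split=> x.
  by case=> y yP <-; exists y => //; rewrite opprB addrC subrK.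
by case=> y yP e; exists y => //; rewrite e opprB addrC subrK.
Qed.

Lemma dilate0 P : dilate 0 P `<=` [set 0].
Proof. by move=> _ [y _ <-]; rewrite scale0r. Qed.

End PolyhedronConstructions.

(** * Box-integrality and Caratheodory property of generalized polymatroids *)

Section GpolyBoxInteger.
Variables (R : realType) (E : finType).
Implicit Types (p q : gpm E) (x y z w : {ffun E -> R^o}).

Lemma gpoly_rational_polyhedron p :
  is_rational_polyhedron (gpoly p : set {ffun E -> R^o}).
Proof.
pose s (j : bool * {set E}) : rat := if j.1 then (if bd p then -1 else 0) else 1.
pose b (j : bool * {set E}) : int :=
  if j.1 then (if bd p then - lo p j.2 else 0) else up p j.2.
have -> : gpoly p = [set x : {ffun E -> R^o} |
    forall j, dotp (fun i => ratr (s j * (i \in j.2)%:R)) x <= ratr (b j)%:~R].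
  have dotpE j x :
      dotp (fun i => ratr (s j * (i \in j.2)%:R)) x = ratr (s j) * vsum x j.2.
    rewrite -dotp_indicator; apply: eq_bigr => i _.
    by rewrite rmorphM /= ratr_nat.
  apply/seteqP; split=> x xP.
    move=> [low U]; rewrite dotpE ratr_int /s /b /=.
    have [xu xl] := xP U; case: low; last by rewrite rmorph1 mul1r.
    case: (bd p) xl => [/(_ isT)|_]; last by rewrite rmorph0 mul0r.
    by rewrite rmorphN1 mulN1r rmorphN lerN2.
  move=> U; have := xP (false, U); have := xP (true, U).
  rewrite !dotpE !ratr_int /s /b /=; case: (bd p).
    by rewrite rmorphN1 rmorph1 mulN1r mul1r rmorphN lerN2.
  by rewrite rmorph1 mul1r.
exact: rational_polyhedron_fin.
Qed.

(** Enclose a point [x0] of the face between its floors and ceilings. As finite bounds of [box c d]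
    are integers, the smaller box lies inside, and an integral vertex that keeps the maximum of
    [dotp a] lies in the face. *)
Lemma box_integer_gpolyI p q w : paramodular p -> paramodular q ->
  integral_vector w ->
  box_integer (gpoly p `&` [set x : {ffun E -> R^o} | gpoly q (w - x)]).
Proof.
move=> pP qP wZ; set Q := _ `&` _.
have polyQ : is_polyhedron Q.
  apply: polyhedronI; last apply: polyhedron_reflect;
    exact/rational_polyhedron_polyhedron/gpoly_rational_polyhedron.
split=> // c d _; split; first exact/polyhedronI/polyhedron_box.
move=> F [a [delta [amax ->]]] [x0 [[[x0p x0q] x0box] ax0]].
have round z : boxed p (fun e => Num.floor (x0 e)) (fun e => Num.ceil (x0 e)) z ->
    box c d z.
  move=> [_ zb] e; have /andP[fz zc] := zb e; have [] := x0box e.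
  case: (c e) => [c'| |]; case: (d e) => [d'| |] //=;
    rewrite ?leey ?leNye ?lee_fin //.
  - move=> cx xd; split.
      by apply: le_trans fz; rewrite ler_int floor_ge_int.
    by apply: (le_trans zc); rewrite ler_int ceil_le_int.
  - by move=> cx _; split=> //; apply: le_trans fz; rewrite ler_int floor_ge_int.
  - by move=> _ xd; split=> //; apply: (le_trans zc); rewrite ler_int ceil_le_int.
have floor_box r z : gpoly r z ->
    boxed r (fun e => Num.floor (z e)) (fun e => Num.ceil (z e)) z.
  by move=> zr; split=> // e; rewrite floor_le ceil_ge.
have [y [yZ yp yq yface _]] :=
  integral_vertex pP qP wZ (floor_box _ _ x0p) (floor_box _ _ x0q).
exists y => //; split; first by split; [split; [exact: yp.1|exact: yq.1]|exact: round yp].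
rewrite -ax0; apply: yface => z zp zq; rewrite ax0; apply: amax.
by split; [split; [exact: zp.1|exact: zq.1]|exact: round zp].
Qed.

(** At [n = 0] the right-hand side is a cone, whereas the left-hand side contains at most the
    origin. *)
Lemma dilate_gpoly p n : (0 < n)%N ->
  dilate n%:R (gpoly p) = gpoly (gpm_scale n p) :> set {ffun E -> R^o}.
Proof.
move=> n0; have n0R : (0 : R) < n%:R by rewrite ltr0n.
apply/seteqP; split=> x.
  case=> y yP <- U; have [yu yl] := yP U; rewrite vsumZ /= !rmorphMn /=
    -(mulr_natl (up p U)%:~R) -(mulr_natl (lo p U)%:~R).
  by split=> [|/yl]; rewrite ler_pM2l.
move=> xP; exists ((n%:R^-1 : R) *: x); last by rewrite scalerA divff ?scale1r ?gt_eqF.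
move=> U; have [] := xP U; rewrite vsumZ /= !rmorphMn /=
    -(mulr_natl (up p U)%:~R) -(mulr_natl (lo p U)%:~R) => xu xl.
by rewrite ler_pdivrMl // ler_pdivlMl.
Qed.

Lemma box_integer_class_gpoly p :
  paramodular p -> box_integer_class (gpoly p : set {ffun E -> R^o}).
Proof.
move=> pP; split; first exact: gpoly_rational_polyhedron.
move=> k r w rk wZ; rewrite reflect_dilateE.
have [->|r0] := posnP r.
  apply: (@box_integer_subsingleton _ _ 0); first by move=> e; rewrite ffunE rpred0.
  exact: subset_trans (@subIsetl _ _ _) (@dilate0 _ _ _).
have [->|kr0] := posnP (k - r)%N.
  apply: (@box_integer_subsingleton _ _ w) => // x [_ /dilate0 /= wx].
  by apply/esym/eqP; rewrite -subr_eq0; apply/eqP.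
rewrite !dilate_gpoly //.
by apply: box_integer_gpolyI => //; apply: paramodular_scale.
Qed.

Lemma integer_caratheodory_gpoly p :
  paramodular p -> integer_caratheodory (gpoly p : set {ffun E -> R^o}).
Proof.
move=> pP; split.
  exact/rational_polyhedron_polyhedron/gpoly_rational_polyhedron.
move=> k w k0 wZ [x xp xw]; move: wZ; rewrite -xw => kxZ.
exact: caratheodory_gpoly kxZ xp.
Qed.

End GpolyBoxInteger.

(** * Projections *)

Section Projection.
Variables (R : realType) (E : finType).
Implicit Types (p : gpm E) (x y : {ffun E -> R^o}) (S U A B : {set E}).

Definition gpm_restrict p S : gpm {i : E | i \in S} :=
  Gpm (fun V : {set {i : E | i \in S}} => up p (val @: V))
      (fun V : {set {i : E | i \in S}} => lo p (val @: V)) (bd p).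

Lemma paramodular_restrict p S : paramodular p -> paramodular (gpm_restrict p S).
Proof.
have imI (A B : {set {i : E | i \in S}}) :
    val @: (A :&: B) = (val @: A) :&: (val @: B) :> {set E}.
  by rewrite imsetI // => a b _ _; apply: val_inj.
have imD (A B : {set {i : E | i \in S}}) :
    val @: (A :\: B) = (val @: A) :\: (val @: B) :> {set E}.
  apply/setP => e; rewrite inE; apply/imsetP/andP.
    case=> a; rewrite inE => /andP[aB aA] ->.
    by rewrite !(mem_imset _ _ val_inj) aA aB.
  case=> eB /imsetP[a aA ea]; exists a => //.
  by rewrite inE aA andbT; apply: contra eB => aB; rewrite ea imset_f.
case=> sub super cross; split=> /=.
- by move=> A B; rewrite imsetU imI sub.
- by move=> b A B; rewrite imsetU imI super.
- by move=> b A B; rewrite !imD cross.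
Qed.

Definition gpoly_on p S x : Prop :=
  forall U, U \subset S -> vsum x U <= (up p U)%:~R /\
                           (bd p -> (lo p U)%:~R <= vsum x U).

(** The new coordinate gets the largest value that the upper bounds permit; the cross inequality
    then yields the lower bounds. *)
Lemma gpoly_on_extend1 p S x e : paramodular p -> e \notin S -> gpoly_on p S x ->
  exists y, gpoly_on p (e |: S) y /\ forall i, i != e -> y i = x i.
Proof.
move=> [_ _ cross] eS xS.
(* The bound that the set [e |: B] imposes on the new coordinate. *)
pose F B : R := (up p (e |: B))%:~R - vsum x B.
have S0 : (fun B => B \subset S) finset.set0 := finset.sub0set S.
case: (@Order.TotalTheory.arg_minP _ _ _ _ (fun B => B \subset S) F S0) => B BS Bmin.
exists [ffun i => if i == e then F B else x i]; set y := finfun _.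
have yx i : i != e -> y i = x i by move=> ie; rewrite ffunE (negbTE ie).
have notin A : A \subset S -> e \notin A.
  by move=> AS; apply: contra eS; apply/fintype.subsetP.
have vsum_y A : e \notin A -> vsum y A = vsum x A.
  move=> eA; apply: eq_bigr => i iA; apply: yx.
  by apply: contraNneq eA => <-.
split=> // U US; have [eU|eU] := boolP (e \in U); last first.
  rewrite vsum_y //; apply: xS; apply/fintype.subsetP => i iU.
  have := fintype.subsetP US i iU; rewrite !inE => /orP[/eqP ie|//].
  by rewrite -ie iU in eU.
pose A := U :\ e.
have AS : A \subset S by rewrite finset.subDset.
have UE : U = e |: A by rewrite finset.setD1K.
have yU : vsum y U = F B + vsum x A.
  rewrite UE /vsum big_setU1 ?notin //= ffunE eqxx; congr (_ + _).
  exact: vsum_y (notin _ AS).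
rewrite yU UE; split; first by have := Bmin A AS; rewrite /F; lra.
move=> b; have := cross b (e |: B) (e |: A).
have DD (C D : {set E}) : e \notin C -> (e |: C) :\: (e |: D) = C :\: D.
  move=> eC; apply/setP => i; rewrite !inE.
  by have [->|] := eqVneq i e; rewrite //= (negbTE eC) andbF.
rewrite !DD ?notin // -(ler_int R) !rmorphB /= => cr.
have subS (C D : {set E}) : C \subset S -> C :\: D \subset S.
  by apply: fintype.subset_trans; apply: finset.subsetDl.
have [u1 _] := xS _ (subS B A BS); have [_ /(_ b) u2] := xS _ (subS A B AS).
by have := vsum_setDD x B A; rewrite /F; lra.
Qed.

Lemma gpoly_on_extend p S x : paramodular p -> gpoly_on p S x ->
  exists2 y, gpoly p y & forall i, i \in S -> y i = x i.
Proof.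
move=> pP; have [n] := ubnP #|~: S|; elim: n S x => // n IHn S x ltn xS.
have [e eS|all] := pickP [pred e | e \notin S]; last first.
  exists x => // U; apply: xS; apply/fintype.subsetP => e _.
  by have /negbT := all e; rewrite negbK.
have [y [yS yx]] := gpoly_on_extend1 pP eS xS.
have [|z zp zy] := IHn _ _ _ yS.
  rewrite -ltnS; apply: leq_trans ltn; rewrite ltnS.
  apply: proper_card.
  apply/properP; split; first by rewrite finset.setCS finset.subsetUr.
  by exists e; rewrite !inE ?eqxx.
exists z => // i iS; rewrite zy ?inE ?iS ?orbT //; apply: yx.
by apply: contraTneq iS => ->.
Qed.

Lemma vsum_restrict S x (U : {set {i : E | i \in S}}) :
  vsum ([ffun j => x (val j)] : {ffun {i : E | i \in S} -> R^o}) U = vsum x (val @: U).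
Proof.
rewrite /vsum big_imset /=; last by move=> a b _ _; apply: val_inj.
by apply: eq_bigr => j _; rewrite ffunE.
Qed.

Lemma projection_gpoly p S : paramodular p ->
  projection S (gpoly p) =
  gpoly (gpm_restrict p S) :> set {ffun {i : E | i \in S} -> R^o}.
Proof.
move=> pP; apply/seteqP; split=> x.
  by case=> y yp <- U; rewrite vsum_restrict; apply: yp.
(* The value 0 outside [S] is a placeholder, to be replaced by [gpoly_on_extend]. *)
move=> xP; pose x' : {ffun E -> R^o} := [ffun i => oapp x 0 (insub i)].
have x'E : [ffun j => x' (val j)] = x.
  by apply/ffunP => j; rewrite !ffunE valK.
have x'S : gpoly_on p S x'.
  move=> U US; pose V : {set {i : E | i \in S}} := [set j | val j \in U]%SET.
  have VU : val @: V = U.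
    apply/setP => i; apply/imsetP/idP => [[j + ->]|iU]; first by rewrite inE.
    have iS := fintype.subsetP US i iU.
    by exists (Sub i iS); rewrite ?inE SubK.
  by have := xP V; rewrite -x'E vsum_restrict /= VU.
have [y yp yx] := gpoly_on_extend pP x'S.
exists y => //; rewrite -x'E; apply/ffunP => j; rewrite !ffunE yx ?ffunE //.
exact: valP.
Qed.

End Projection.

(** * The three polyhedra as generalized polymatroids *)

Section Polymatroids.
Variables (R : realType) (E : finType) (f : {set E} -> int).
Hypothesis f_submodular : submodular f.

Lemma empty_gpoly : exists2 p : gpm E, paramodular p &
  gpoly p = set0 :> set {ffun E -> R^o}.
Proof.
exists (Gpm (fun=> -1) (fun=> 0) false); first by split=> // A B.
apply/seteqP; split=> // x /(_ finset.set0)[/= + _].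
by rewrite vsum_set0 rmorphN1; lra.
Qed.

Lemma extended_polymatroid_gpoly : exists2 p : gpm E, paramodular p &
  extended_polymatroid R f = gpoly p.
Proof.
exists (Gpm f f false); first by split.
by apply/seteqP; split=> x xP U; have := xP U; [split|case].
Qed.

(** The largest monotone function below [f]. *)
Definition monotone_closure (U : {set E}) : int :=
  f [arg min_(V < [set: E]%SET | U \subset (V : {set E})) f V]%O.

Lemma monotone_closureP (U : {set E}) :
  (exists2 V : {set E}, U \subset V & monotone_closure U = f V) /\
  forall V : {set E}, U \subset V -> monotone_closure U <= f V.
Proof.
rewrite /monotone_closure; case: arg_minP => [|V UV Vmin]; first exact: finset.subsetT.
by split=> //; exists V.
Qed.

(** For nonnegative [x], sums grow with the set, so [f] and its monotone closure give the same
    polyhedron. With lower bound 0 the cross inequality is monotonicity. *)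
Lemma polymatroid_gpoly : exists2 p : gpm E, paramodular p &
  polymatroid R f = gpoly p.
Proof.
exists (Gpm monotone_closure (fun=> 0) true).
  split=> //= [A B|_ A B].
    have [[A' AA' ->] _] := monotone_closureP A.
    have [[B' BB' ->] _] := monotone_closureP B.
    have [_ leU] := monotone_closureP (A :|: B).
    have [_ leI] := monotone_closureP (A :&: B).
    apply: le_trans (f_submodular A' B'); apply: lerD.
      by apply: leU; apply: finset.setUSS.
    by apply: leI; apply: finset.setISS.
  rewrite !subr0; have [[A' AA' ->] _] := monotone_closureP A.
  have [_ le] := monotone_closureP (A :\: B); apply: le.
  exact: fintype.subset_trans (finset.subsetDl _ _) AA'.
apply/seteqP; split=> x.
  move=> [xE x0] U; split=> //=; have [[V UV ->] _] := monotone_closureP U.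
  apply: le_trans (xE V); rewrite (vsumID x V U).
  by rewrite (finset.setIidPr UV) lerDl.
move=> xP; split=> U; have [xu /(_ isT) xl] := xP U; last exact: xl.
apply: le_trans xu _; rewrite ler_int.
by have [_ le] := monotone_closureP U; apply: le.
Qed.

(* If [f set0 > 0], lowering this value to [0] keeps [f] submodular and does  *)
(* not change the polyhedron; it makes [f setT - f (~: U)] a lower bound      *)
(* whose value at [setT] is [f setT].                                         *)
Lemma base_polytope_gpoly : exists2 p : gpm E, paramodular p &
  base_polytope R f = gpoly p.
Proof.
have [[x0 [x0E x0T]]|empty] := pselect (base_polytope R f !=set0); last first.
  have [p pP pE] := empty_gpoly; exists p => //; rewrite pE.
  by apply/seteqP; split=> // x xB; apply: empty; exists x.
have f0 : 0 <= f finset.set0.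
  by have := x0E finset.set0; rewrite vsum_set0 ler0z.
pose g U : int := if U == finset.set0 then 0 else f U.
have gf U : g U <= f U by rewrite /g; case: eqP => // ->.
(* If [E] is empty, the base equation at [x0] gives [f] the value 0 there. *)
have gT : g [set: E]%SET = f [set: E]%SET.
  rewrite /g; case: eqP => // T0; move: x0T; rewrite T0 vsum_set0 => /esym/eqP.
  by rewrite intr_eq0 => /eqP.
have g_sub : submodular g.
  move=> A B; have [->|A0] := eqVneq A finset.set0.
    by rewrite finset.set0U finset.set0I addrC.
  have [->|B0] := eqVneq B finset.set0.
    by rewrite finset.setU0 finset.setI0.
  rewrite {3 4}/g (negbTE A0) (negbTE B0).
  by apply: le_trans (f_submodular A B); apply: lerD.
exists (Gpm g (fun U => g [set: E]%SET - g (~: U)) true).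
  split=> //= [_ A B|_ A B].
    by have := g_sub (~: A) (~: B); rewrite finset.setCU finset.setCI; lra.
  (* The cross inequality for [A] and [B] is submodularity for [A] and the complement of [B]. *)
  have := g_sub A (~: B); rewrite -finset.setDE.
  have -> : A :|: ~: B = ~: (B :\: A).
    by apply/setP => i; rewrite !inE negb_and negbK.
  by lra.
apply/seteqP; split=> x.
  move=> [xE xT].
  have xg U : vsum x U <= (g U)%:~R.
    by rewrite /g; case: eqP => [->|_]; rewrite ?vsum_set0.
  move=> U; split=> //= _; rewrite rmorphB /= gT -xT.
  by have := xg (~: U); rewrite vsum_setC; lra.
move=> xP; split=> [U|].
  by have [xu _] := xP U; apply: le_trans xu _; rewrite ler_int.
have [+ /(_ isT)] := xP [set: E]%SET.
rewrite /= finset.setCT {3}/g eqxx subr0 gT => xu xl.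
by apply/eqP; rewrite eq_le xu xl.
Qed.

End Polymatroids.

Theorem theorem10 (R : realType) (E : finType) (f : {set E} -> int)
    (f_submodular : submodular f) :
  forall P : set {ffun E -> R^o},
    [\/ P = extended_polymatroid R f, P = polymatroid R f
      | P = base_polytope R f] ->
    [/\ box_integer_class P,
        integer_caratheodory P
      & forall S : {set E}, integer_caratheodory (projection S P)].
Proof.
move=> P Pf; have [p pP ->] : exists2 p : gpm E, paramodular p & P = gpoly p.
  case: Pf => ->; [exact: extended_polymatroid_gpoly|
    exact: polymatroid_gpoly|exact: base_polytope_gpoly].
split; [exact: box_integer_class_gpoly|exact: integer_caratheodory_gpoly|].
move=> S; rewrite projection_gpoly //.
by apply: integer_caratheodory_gpoly; apply: paramodular_restrict.
Qed.
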